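(* Let $N>1$ be an integer. Then there does not exist an infinite number of primes $p$ such that the cyclic group $\mathbb Z_p$ contains an extreme set of cardinality $N$.
   Context: $\mathbb Z_n$ denotes the cyclic group of order $n$. For a discrete abelian group $G$ with (compact) dual group $\Gamma$, a measure on $G$ is a complex measure $\mu$ with $\|\mu\|=\sum_{x\in G}|\mu(\{x\})|<\infty$; its transform is $\widehat\mu(\gamma)=\sum_{x\in G}\overline{\gamma(x)}\,\mu(\{x\})$ for $\gamma\in\Gamma$, and $\|\widehat\mu\|_\infty=\sup_{\gamma\in\Gamma}|\widehat\mu(\gamma)|$. A non-zero finitely supported measure $\mu$ on $G$ is extreme if $\|\widehat\mu\|_\infty=\|\mu\|/\sqrt{\#\mathrm{supp}\,\mu}$. A finite set $E\subset G$ is extreme if it is the support of an extreme measure on $G$. *)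

(* Defs.v *)
From HB Require Import structures.
From mathcomp Require Import all_boot all_order all_algebra finmap.
From mathcomp Require Import all_classical all_reals.
From mathcomp Require Export complex.

Set Implicit Arguments.
Unset Strict Implicit.
Unset Printing Implicit Defensive.

Import Order.TTheory GRing.Theory Num.Theory.

Local Open Scope classical_set_scope.
Local Open Scope ring_scope.

(* Only finitely supported measures can be extreme, so a measure is represented
   by its mass function x |-> mu {x}, with [finsupp mu] as its support. *)
Notation fsmeasure R G := {fsfun G -> R[i] for fun=> 0}.

(* The unitary characters of the discrete group G (every homomorphism to the
   circle is continuous). *)
Definition dual_group (R : realType) (G : zmodType) : set (G -> R[i]) :=
  [set g | (forall x, `|g x| = 1) /\ (forall x y, g (x + y) = g x * g y)].

Definition mass_norm (R : realType) (G : zmodType) (mu : fsmeasure R G) : R :=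
  \sum_(x <- finsupp mu) Normc.normc (mu x).

Definition transform (R : realType) (G : zmodType) (mu : fsmeasure R G)
    (g : G -> R[i]) : R[i] :=
  \sum_(x <- finsupp mu) (g x)^* * mu x.

Definition transform_abs_values (R : realType) (G : zmodType)
    (mu : fsmeasure R G) : set R :=
  [set Normc.normc (transform mu g) | g in @dual_group R G].

(* The set is nonempty and bounded, so [sup] is its least upper bound: see
   [has_sup_transform]. *)
Definition transform_sup_norm (R : realType) (G : zmodType)
    (mu : fsmeasure R G) : R :=
  sup (transform_abs_values mu).

Definition extreme_measure (R : realType) (G : zmodType)
    (mu : fsmeasure R G) : Prop :=
  mu != [fsfun] /\
  transform_sup_norm mu = mass_norm mu / Num.sqrt (#|` finsupp mu|%:R).

Definition extreme_set (R : realType) (G : zmodType) (E : {fset G}) : Prop :=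
  exists2 mu : fsmeasure R G, extreme_measure mu & finsupp mu = E.

Lemma has_sup_transform (R : realType) (G : zmodType) (mu : fsmeasure R G) :
  has_sup (transform_abs_values mu).
Proof.
split.
  exists (Normc.normc (transform mu (fun=> 1))), (fun=> 1) => //.
  by split=> [x | x y]; rewrite ?normr1 ?mulr1.
exists (mass_norm mu) => _ [g [g1 _]] <-.
rewrite -lecR /mass_norm raddf_sum /=.
rewrite [leLHS](_ : _ = `|transform mu g|) // /transform.
apply: le_trans (ler_norm_sum _ _ _) _; apply: ler_sum => x _.
by rewrite normrM norm_conjC g1 mul1r.
Qed.

(* Main.v *)
Require Import Defs.
From mathcomp Require Import all_boot all_order all_algebra finmap.
From mathcomp Require Import all_classical all_reals.
From mathcomp Require Import zify ring.

(** An extreme set of cardinality N in Z_p forces p <= 4 ^ N, so only finitely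
    many primes p can occur.

    The Fourier side.  Let mu be supported on E with #|E| = N.  Parseval and
    Cauchy-Schwarz say that the average of |mu^|^2 over the dual group is
      sum |mu x|^2 >= (sum |mu x|)^2 / N,
    and extremality says that the right-hand side is the maximum of |mu^|^2.
    A function whose average reaches its maximum is constant, so |mu^| is flat
    ([extreme_transform_flat]).  Since |mu^|^2 is the transform of the
    autocorrelation of mu, flatness means that the autocorrelation
      d |-> sum over x - y = d of mu x * conj (mu y)
    vanishes at every d <> 0 ([extreme_autocorrelation]).

    The arithmetic side.  If 4 ^ N < p, simultaneous approximation gives a
    nonzero q such that q E has representatives r x in the interval
    ]-p/4, p/4[ ([small_dilate]).  Differences of these then behave as in Z:
    two of them congruent modulo p are equal.  If r is maximal at a and minimal
    at b, the difference a - b is thus represented only once in E - E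
    ([unique_difference]), and the autocorrelation at a - b is the single
    nonzero term mu a * conj (mu b), a contradiction. *)

Set Implicit Arguments.
Unset Strict Implicit.
Unset Printing Implicit Defensive.

Import Order.TTheory GRing.Theory Num.Theory.

Local Open Scope classical_set_scope.
Local Open Scope ring_scope.

(** * Dilating a small set of residues *)

Lemma intr_Zp_small (p : nat) (n : int) :
  (1 < p)%N -> (`|n| < p)%N -> n%:~R = 0 :> 'Z_p -> n = 0.
Proof.
move=> p1 np n0.
have : `|n|%:R = 0 :> 'Z_p.
  by case: n np n0 => n // _; rewrite NegzE mulrNz => /eqP; rewrite oppr_eq0 => /eqP.
move=> /(congr1 (@nat_of_ord _)); rewrite val_Zp_nat // modn_small //=.
by move/eqP; rewrite absz_eq0 => /eqP.
Qed.

Lemma mulZp_prime_inj (p : nat) (q : 'Z_p) :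
  prime p -> q != 0 -> injective ( *%R q).
Proof.
move=> pp q0; apply: mulrI.
have p1 := prime_gt1 pp.
rewrite -[q]natr_Zp unitZpE // prime_coprime //.
apply: contra q0 => pq; apply/eqP/val_inj => /=.
have qp : (q < p)%N by rewrite -[X in (_ < X)%N](Zp_cast p1).
by move: pq; rewrite /dvdn modn_small // => /eqP.
Qed.

(** Dirichlet's simultaneous approximation, by pigeonhole: each multiplier k < p
    places the residues k x, x in E, into four boxes of length p/4.  There are
    only 4 ^ #|E| placements, so two multipliers k1, k2 agree on all of E, and
    the residues of k1 x and k2 x then differ by less than p/4. *)
Lemma small_dilate (p : nat) (E : {fset 'Z_p}) :
  (1 < p)%N -> (4 ^ #|` E| < p)%N ->
  exists q : 'Z_p, exists r : 'Z_p -> int,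
    [/\ q != 0, forall x, (r x)%:~R = q * x
      & {in E, forall x, (4 * `|r x| < p)%N}].
Proof.
move=> p1 Ep.
pose u (k : 'I_p) (x : 'Z_p) := (k * x %% p)%N.
have up k x : (u k x < p)%N by rewrite ltn_mod; lia.
have uE k x : (u k x)%:R = k%:R * x :> 'Z_p.
  by apply: ord_inj; rewrite -[in RHS](natr_Zp x) -natrM !val_Zp_nat // modn_mod.
pose f k : {ffun E -> 'I_4} := [ffun x => inord (4 * u k (val x) %/ p)].
have /injectivePn[k1 [k2 k12 fk]] : ~~ injectiveb f.
  apply/injectiveP => /leq_card.
  by rewrite card_ffun !card_ord -cardfE leqNgt Ep.
exists (k1%:R - k2%:R), (fun x => (u k1 x)%:Z - (u k2 x)%:Z); split.
- rewrite subr_eq0; apply: contraNneq k12.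
  move=> /(congr1 (@nat_of_ord _)); rewrite !val_Zp_nat // !modn_small // => k12.
  exact/eqP/val_inj.
- by move=> x; rewrite rmorphB /= mulrBl -!uE.
- move=> x xE; move/ffunP: fk => /(_ [` xE]%fset); rewrite !ffunE /=.
  move=> /(congr1 (@nat_of_ord _)).
  rewrite !inordK; try by rewrite ltn_divLR ?ltn_pmul2l ?up; lia.
  move: (up k1 x) (up k2 x).
  move: (u k1 x) (u k2 x) => a b ap bp ab.
  have := divn_eq (4 * a) p; have := divn_eq (4 * b) p; rewrite ab.
  have : (4 * a %% p < p)%N by rewrite ltn_mod; lia.
  have : (4 * b %% p < p)%N by rewrite ltn_mod; lia.
  lia.
Qed.

(** After dilation, a and b are the elements of E with the largest and the
    smallest representative.  In Z the extreme difference r a - r b is attained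
    only at the pair (a, b); passing to residues loses nothing, because all
    differences of representatives lie in ]-p/2, p/2[. *)
Lemma unique_difference (p : nat) (E : {fset 'Z_p}) :
  prime p -> (1 < #|` E|)%N -> (4 ^ #|` E| < p)%N ->
  exists a b : 'Z_p, [/\ a \in E, b \in E, a != b &
    {in E &, forall x y, x - y = a - b -> x = a /\ y = b}].
Proof.
move=> pp E1 Ep; have p1 := prime_gt1 pp.
have [q [r [q0 rE rp]]] := small_dilate p1 Ep.
have r_inj : injective r.
  by move=> x y /(congr1 (fun n => n%:~R : 'Z_p)); rewrite !rE; apply: mulZp_prime_inj.
have /fset0Pn[x0 x0E] : E != fset0 by rewrite -cardfs_gt0 ltnW.
pose e0 := [` x0E]%fset.
have [a aE amax] : exists2 a, a \in E & {in E, forall x, r x <= r a}.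
  have [a _ amax] := @arg_maxP _ _ _ e0 xpredT (fun x : E => r (val x)) isT.
  by exists (val a) => [|x xE]; [exact: valP | exact: (amax [` xE]%fset)].
have [b bE bmin] : exists2 b, b \in E & {in E, forall x, r b <= r x}.
  have [b _ bmin] := @arg_minP _ _ _ e0 xpredT (fun x : E => r (val x)) isT.
  by exists (val b) => [|x xE]; [exact: valP | exact: (bmin [` xE]%fset)].
exists a, b; split=> //.
- apply: contraTneq E1 => ab; rewrite -leqNgt.
  suff -> : E = [fset a]%fset by rewrite cardfs1.
  apply/fsetP => x; rewrite in_fset1; apply/idP/eqP => [xE | -> //].
  by apply: r_inj; have := amax x xE; have := bmin x xE; rewrite -ab; lia.
- move=> x y xE yE xy.
  have rxy : r x - r y - (r a - r b) = 0.
    apply: (intr_Zp_small p1).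
      by move: (rp x xE) (rp y yE) (rp a aE) (rp b bE); lia.
    by rewrite !rmorphB /= !rE -!mulrBr xy subrr mulr0.
  have := amax x xE; have := bmin y yE.
  by split; apply: r_inj; lia.
Qed.

(** * Characters of Z_p *)

(** A root z of 1 + X + ... + X^(p-1) satisfies z ^+ p = 1, so its order is 1
    or p; it is not 1 because the polynomial takes the value p <> 0 there. *)
Lemma prim_root_prime_exists (C : numClosedFieldType) (p : nat) :
  prime p -> exists z : C, p.-primitive_root z.
Proof.
move=> pp; have p1 := prime_gt1 pp.
have [z] : exists z : C, root (\poly_(i < p) 1) z.
  by apply/closed_rootP; rewrite size_poly_eq ?oner_eq0 //; lia.
rewrite rootE horner_poly => /eqP.
under eq_bigr do rewrite mul1r.
move=> z0; have zp : z ^+ p = 1 by apply/eqP; rewrite -subr_eq0 subrX1 z0 mulr0.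
have [m zm] := prim_order_exists (ltnW p1) zp.
case/primeP: pp => _ H /H/orP[]/eqP Em; last by exists z; rewrite -Em.
move: zm z0; rewrite Em => /prim_expr_order; rewrite expr1 => ->.
under eq_bigr do rewrite expr1n.
by rewrite sumr_const card_ord => /eqP; rewrite pnatr_eq0; lia.
Qed.

(** For z a primitive p-th root of unity and k < p these are all the characters
    of Z_p.  The exponent uses the representative of x in [0, p[. *)
Definition chi (C : nzRingType) (p : nat) (z : C) (k : nat) (x : 'Z_p) : C :=
  z ^+ (k * x).

Lemma chiD (C : nzRingType) (p : nat) (z : C) (k : nat) (x y : 'Z_p) :
  (1 < p)%N -> z ^+ p = 1 -> chi z k (x + y) = chi z k x * chi z k y.
Proof.
move=> p1 zp; have zkp : z ^+ k ^+ (Zp_trunc p).+2 = 1.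
  by rewrite Zp_cast // exprAC zp expr1n.
by rewrite /chi !exprM -exprD /= expr_mod.
Qed.

Lemma norm_root_unity (C : numClosedFieldType) (p : nat) (z : C) :
  (0 < p)%N -> z ^+ p = 1 -> `|z| = 1.
Proof.
move=> p0 zp; apply/eqP; rewrite -(pexpr_eq1 (n := p)) ?normr_ge0 ?gtn_eqF //.
by rewrite -normrX zp normr1.
Qed.

Lemma chi_dual (R : realType) (p : nat) (z : R[i]) (k : nat) :
  (1 < p)%N -> z ^+ p = 1 -> @dual_group R 'Z_p (chi z k).
Proof.
move=> p1 zp; split=> [x | x y]; last exact: chiD.
by rewrite /chi normrX (norm_root_unity (ltnW p1) zp) expr1n.
Qed.

Lemma conj_dual (R : realType) (G : zmodType) (g : G -> R[i]) (x : G) :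
  dual_group g -> (g x)^* = g (- x).
Proof.
move=> [g1 gD].
have gx0 : g x != 0 by rewrite -normr_eq0 g1 oner_eq0.
apply: (mulfI gx0); rewrite -normCK g1 expr1n -gD subrr.
have g00 : g 0 != 0 by rewrite -normr_eq0 g1 oner_eq0.
by apply: (mulfI g00); rewrite mulr1 -gD addr0.
Qed.

Lemma sum_chi (C : fieldType) (p : nat) (z : C) (d : 'Z_p) :
  (1 < p)%N -> p.-primitive_root z ->
  \sum_(k < p) chi z k d = if d == 0 then p%:R else 0.
Proof.
move=> p1 zp; case: eqP => [-> | /eqP d0].
  under eq_bigr do rewrite /chi muln0 expr0.
  by rewrite sumr_const card_ord.
under eq_bigr do rewrite /chi mulnC exprM.
have zd : z ^+ d - 1 != 0.
  rewrite subr_eq0 -(prim_order_dvd zp) /dvdn modn_small //.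
  by rewrite -[X in (_ < X)%N](Zp_cast p1).
apply: (mulfI zd); rewrite mulr0 -subrX1 -exprM mulnC exprM.
by rewrite (prim_expr_order zp) expr1n subrr.
Qed.

(** * The transform of an extreme measure *)

Lemma conj_transform (R : realType) (G : zmodType) (mu : fsmeasure R G)
    (g : G -> R[i]) :
  (transform mu g)^* = \sum_(x <- finsupp mu) g x * (mu x)^*.
Proof.
rewrite rmorph_sum; apply: eq_bigr => x _.
by rewrite rmorphM; congr (_ * _); apply: conjCK.
Qed.

(** Fourier inversion of |mu^|^2: expanding it as a double sum over x and y
    produces the characters chi_k (d - (x - y)), and orthogonality keeps exactly
    the pairs with x - y = d. *)
Lemma sum_chi_transform (R : realType) (p : nat) (z : R[i])
    (mu : fsmeasure R 'Z_p) (d : 'Z_p) :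
  (1 < p)%N -> p.-primitive_root z ->
  \sum_(k < p) chi z k d * `|transform mu (chi z k)| ^+ 2 =
  p%:R * \sum_(x <- finsupp mu) \sum_(y <- finsupp mu | x - y == d)
            mu x * (mu y)^*.
Proof.
move=> p1 zp; have zp1 := prim_expr_order zp.
transitivity (\sum_(k < p) \sum_(x <- finsupp mu) \sum_(y <- finsupp mu)
    chi z k (d - (x - y)) * (mu x * (mu y)^*)).
  apply: eq_bigr => k _.
  have zk := chi_dual k p1 zp1.
  rewrite normCK conj_transform /transform mulr_suml mulr_sumr.
  apply: eq_bigr => x _; rewrite !mulr_sumr; apply: eq_bigr => y _.
  rewrite (conj_dual x zk) opprB addrCA addrC !(chiD k _ _ p1 zp1).
  ring.
rewrite exchange_big /= mulr_sumr; apply: eq_bigr => x _.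
rewrite exchange_big /= mulr_sumr [RHS]big_mkcond /=; apply: eq_bigr => y _.
rewrite -mulr_suml sum_chi // subr_eq0 eq_sym.
by case: eqP; rewrite ?mul0r.
Qed.

(** Cauchy-Schwarz against a constant function.  With n the size and S the sum,
    the defect is, up to the factor n, the sum of the squares (n f x - S)^2. *)
Lemma sqr_sum_le (R : realFieldType) (T : eqType) (s : seq T) (f : T -> R) :
  (\sum_(x <- s) f x) ^+ 2 <= (size s)%:R * \sum_(x <- s) f x ^+ 2.
Proof.
set S := \sum_(x <- s) f x; set Q := \sum_(x <- s) f x ^+ 2.
have [s0 | s_gt0] := posnP (size s).
  by rewrite s0 mul0r /S (size0nil s0) big_nil expr0n.
have nR : 0 < (size s)%:R :> R by rewrite ltr0n.
have var : \sum_(x <- s) ((size s)%:R * f x - S) ^+ 2 =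
    (size s)%:R * ((size s)%:R * Q - S ^+ 2).
  transitivity (\sum_(x <- s) ((size s)%:R ^+ 2 * f x ^+ 2
      - 2 * (size s)%:R * S * f x + S ^+ 2)).
    by apply: eq_bigr => x _; ring.
  rewrite big_split sumrB /= -!mulr_sumr -/S -/Q big_const_seq count_predT.
  by rewrite iter_addr_0 -mulr_natl; ring.
rewrite -subr_ge0 -(pmulr_rge0 _ nR) -var.
by apply: sumr_ge0 => x _; apply: sqr_ge0.
Qed.

Lemma normc_nneg (R : realType) (w : R[i]) : 0 <= Normc.normc w.
Proof. by case: w => a b; apply: sqrtr_ge0. Qed.

Lemma normc_sqrE (R : realType) (w : R[i]) :
  `|w| ^+ 2 = (Normc.normc w ^+ 2)%:C%C.
Proof. by rewrite rmorphXn. Qed.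

Lemma normc_transform_le (R : realType) (G : zmodType) (mu : fsmeasure R G)
    (g : G -> R[i]) :
  dual_group g -> Normc.normc (transform mu g) <= transform_sup_norm mu.
Proof.
move=> gG; apply: sup_upper_bound; first exact: has_sup_transform.
by exists g.
Qed.

(** The case d = 0 of [sum_chi_transform]. *)
Lemma parseval (R : realType) (p : nat) (z : R[i]) (mu : fsmeasure R 'Z_p) :
  (1 < p)%N -> p.-primitive_root z ->
  \sum_(k < p) Normc.normc (transform mu (chi z k)) ^+ 2 =
  p%:R * \sum_(x <- finsupp mu) Normc.normc (mu x) ^+ 2.
Proof.
move=> p1 zp; apply: complexI.
rewrite rmorphM rmorph_nat !rmorph_sum /=.
transitivity (\sum_(k < p) chi z k (0 : 'Z_p) * `|transform mu (chi z k)| ^+ 2).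
  by apply: eq_bigr => k _; rewrite normc_sqrE /chi muln0 mul1r.
rewrite sum_chi_transform //; congr (_ * _); apply: eq_big_seq => x xE.
rewrite -big_filter (_ : [seq y <- _ | _] = [:: x]).
  by rewrite big_seq1 -normCK normc_sqrE.
rewrite -[RHS](filter_pred1_uniq (fset_uniq _) xE).
by apply: eq_filter => y /=; rewrite subr_eq0 eq_sym.
Qed.

(** The nonnegative numbers S^2 - |mu^ (chi_k)|^2, where S is the sup norm, have a
    sum that is at most 0: by Parseval it is p (S^2 - sum |mu x|^2), and
    extremality turns S^2 <= sum |mu x|^2 into the Cauchy-Schwarz inequality. *)
Lemma extreme_transform_flat (R : realType) (p : nat) (z : R[i])
    (mu : fsmeasure R 'Z_p) (k : 'I_p) :
  (1 < p)%N -> p.-primitive_root z -> extreme_measure mu ->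
  Normc.normc (transform mu (chi z k)) ^+ 2 = transform_sup_norm mu ^+ 2.
Proof.
move=> p1 zp [mu0 muS]; have zp1 := prim_expr_order zp.
set S := transform_sup_norm mu in muS *.
have tS (j : 'I_p) : 0 <= S ^+ 2 - Normc.normc (transform mu (chi z j)) ^+ 2.
  rewrite subr_ge0 ler_sqr ?nnegrE ?(normc_transform_le _ (chi_dual j p1 zp1)) //.
    exact: normc_nneg.
  apply: le_trans (normc_transform_le _ (chi_dual j p1 zp1)); exact: normc_nneg.
have n_gt0 : 0 < #|` finsupp mu|%:R :> R.
  rewrite ltr0n cardfs_gt0; apply: contra mu0 => /eqP mu0; apply/eqP/fsfunP => x.
  by rewrite fsfun0E fsfun_dflt // mu0 in_fset0.
have S2 : S ^+ 2 * #|` finsupp mu|%:R = mass_norm mu ^+ 2.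
  by rewrite muS expr_div_n sqr_sqrtr ?ltW // divfK // gt_eqF.
have : \sum_(j < p) (S ^+ 2 - Normc.normc (transform mu (chi z j)) ^+ 2) <= 0.
  rewrite sumrB parseval // sumr_const card_ord -[S ^+ 2 *+ p]mulr_natl -mulrBr.
  rewrite pmulr_rle0 ?ltr0n ?(ltnW p1) // subr_le0.
  by rewrite -(ler_pM2r n_gt0) S2 [leRHS]mulrC sqr_sum_le.
move=> sum_le0.
have sum0 : \sum_(j < p) (S ^+ 2 - Normc.normc (transform mu (chi z j)) ^+ 2) = 0.
  by apply: le_anti; rewrite sum_le0 sumr_ge0.
have /(_ k isT)/eqP := psumr_eq0P (fun j _ => tS j) sum0.
by rewrite subr_eq0 => /eqP.
Qed.

(** |mu^|^2 is a constant, and the sum of chi_k d over k is 0 for d <> 0, so the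
    left-hand side of [sum_chi_transform] vanishes. *)
Lemma extreme_autocorrelation (R : realType) (p : nat)
    (mu : fsmeasure R 'Z_p) (d : 'Z_p) :
  prime p -> extreme_measure mu -> d != 0 ->
  \sum_(x <- finsupp mu) \sum_(y <- finsupp mu | x - y == d)
     mu x * (mu y)^* = 0.
Proof.
move=> pp muX d0; have p1 := prime_gt1 pp.
have [z zp] := prim_root_prime_exists R[i] pp.
have pC : p%:R != 0 :> R[i] by rewrite pnatr_eq0 gtn_eqF // ltnW.
apply: (mulfI pC); rewrite -(sum_chi_transform _ _ p1 zp) mulr0.
under eq_bigr => k _ do rewrite normc_sqrE (extreme_transform_flat k p1 zp muX).
by rewrite -mulr_suml sum_chi // (negPf d0) mul0r.
Qed.

(** If p were larger, the autocorrelation of mu at the uniquely represented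
    difference a - b would vanish and yet be the one product
    mu a * conj (mu b). *)
Lemma extreme_prime_le (R : realType) (p : nat) (E : {fset 'Z_p}) :
  prime p -> (1 < #|` E|)%N -> extreme_set R E -> (p <= 4 ^ #|` E|)%N.
Proof.
move=> pp E1 [mu muX muE]; rewrite leqNgt; apply/negP => Ep.
have [a [b [aE bE ab uniq_ab]]] := unique_difference pp E1 Ep.
have d0 : a - b != 0 by rewrite subr_eq0.
have := extreme_autocorrelation pp muX d0; rewrite muE.
rewrite (big_fsetD1 a) //= [X in _ + X]big1_seq => [|x /andP[_]]; last first.
  rewrite in_fsetD1 => /andP[xa xE]; rewrite big1_seq // => y /andP[/eqP xy yE].
  by have [/eqP] := uniq_ab x y xE yE xy; rewrite (negPf xa).
rewrite addr0 -big_filter (_ : [seq y <- _ | _] = [:: b]); last first.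
  rewrite -[RHS](filter_pred1_uniq (fset_uniq E) bE).
  by apply: eq_filter => y /=; rewrite (inj_eq (addrI _)) eqr_opp.
apply/eqP; rewrite big_seq1 mulf_neq0 ?conjC_eq0 // -mem_finsupp ?muE //.
Qed.

Theorem lemma2p16 (R : realType) (N : nat) (hN : (1 < N)%N) :
  ~ infinite_set [set p : nat | prime p /\
      exists E : {fset 'Z_p}, #|` E| = N /\ extreme_set R E].
Proof.
suff fin : finite_set [set p : nat | prime p /\
    exists E : {fset 'Z_p}, #|` E| = N /\ extreme_set R E] by apply.
apply: sub_finite_set (finite_II (4 ^ N).+1) => p [pp [E [EN EX]]].
by rewrite /= ltnS -EN (extreme_prime_le (R := R) pp) // EN.
Qed.
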